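(* Let $k$ be a perfect field and $(A,M)$ a finite local commutative $k$-algebra with $M^3=0$. If $A$ is not a principal ideal algebra, then $\tau(A)\neq0$.
   Context: For a perfect field $k$: $\Omega_A=\Omega_{A/k}$. A principal ideal algebra is a finite commutative $k$-algebra in which every ideal is principal; every such algebra is a finite product of truncated polynomial rings $K_i[s]/(s^{n_i})$ with $K_i$ finite field extensions of $k$. A truncated polynomial ring $K[s]/(s^n)$ is tame if $\operatorname{char}K=0$, or $\operatorname{char}K=p>0$ and $p\nmid n$; a principal ideal algebra is tame if it is a product of tame truncated polynomial rings. For a finite $k$-algebra $A$, $\tau(A)\subseteq\Omega_A$ is the intersection of the kernels of $f_*:\Omega_A\to\Omega_B$ over all $k$-algebra homomorphisms $f:A\to B$ with $B$ a tame principal ideal algebra. *)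

(* Defs.v *)
From HB Require Import structures.
From mathcomp Require Import all_boot all_order all_algebra all_field.

Set Implicit Arguments.
Unset Strict Implicit.
Unset Printing Implicit Defensive.

Import GRing.Theory.
Local Open Scope ring_scope.

Definition perfect_field (k : fieldType) : Prop :=
  forall p, p \in [pchar k] -> forall x : k, exists y : k, y ^+ p = x.

Definition finite_kalg (k : fieldType) (A : comAlgType k) : Prop :=
  exists s : seq A, forall a : A,
    exists c : 'I_(size s) -> k, a = \sum_(i < size s) c i *: s`_i.

Definition kalg_hom (k : fieldType) (A B : comAlgType k) (f : A -> B) : Prop :=
  [/\ forall a b, f (a + b) = f a + f b,
      forall a b, f (a * b) = f a * f b,
      f 1 = 1 &
      forall (c : k) a, f (c *: a) = c *: f a].

Definition is_ideal (A : comNzRingType) (I : A -> Prop) : Prop :=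
  [/\ I 0, forall x y, I x -> I y -> I (x + y) &
      forall a x, I x -> I (a * x)].

Definition principal_ideal (A : comNzRingType) (I : A -> Prop) : Prop :=
  exists b : A, forall x, I x <-> exists a : A, x = a * b.

Definition PIA (k : fieldType) (A : comAlgType k) : Prop :=
  finite_kalg A /\ forall I : A -> Prop, is_ideal I -> principal_ideal I.

(* Local ring with maximal ideal M = the non-units: the non-units form an
   ideal; and M^3 = 0 (all triple products of elements of M vanish, which is
   equivalent to the vanishing of the ideal M^3 generated by them). *)
Definition nonunit (k : fieldType) (A : comAlgType k) (x : A) : Prop :=
  ~ exists y : A, x * y = 1.

Definition local_alg (k : fieldType) (A : comAlgType k) : Prop :=
  (0 : A) <> 1 /\ is_ideal (@nonunit k A).

Definition max_cube_zero (k : fieldType) (A : comAlgType k) : Prop :=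
  forall x y z : A, nonunit x -> nonunit y -> nonunit z -> x * y * z = 0.

Definition trunc_poly (K : fieldType) (n : nat) := {poly %/ ('X^n : {poly K})}.

Definition tame_trunc (K : fieldType) (n : nat) : Prop :=
  forall p, p \in [pchar K] -> ~~ (p %| n)%N.

(* B is a tame principal ideal algebra: B is (k-algebra) isomorphic to a
   finite product prod_{i<m} K_i[s]/(s^{n_i}) of tame truncated polynomial
   rings, K_i finite field extensions of k, n_i >= 1.  The product is
   expressed via its universal property: k-algebra maps pi_i : B -> K_i[s]/(s^{n_i})
   (k acting on K_i through k -> K_i) such that b |-> (pi_i b)_i is bijective. *)
Definition tame_PIA (k : fieldType) (B : comAlgType k) : Prop :=
  exists (m : nat) (K : 'I_m -> fieldExtType k) (n : 'I_m -> nat)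
         (pi : forall i : 'I_m, B -> trunc_poly (K i) (n i)),
    [/\ forall i, (0 < n i)%N,
        forall i, tame_trunc (K i) (n i),
        forall i, [/\ forall a b, pi i (a + b) = pi i a + pi i b,
                      forall a b, pi i (a * b) = pi i a * pi i b,
                      pi i 1 = 1 &
                      forall (c : k) a, pi i (c *: a) = (c%:A : K i) *: pi i a],
        forall b b' : B, (forall i, pi i b = pi i b') -> b = b' &
        forall t : forall i : 'I_m, trunc_poly (K i) (n i),
          exists b : B, forall i, pi i b = t i].

Definition kderivation (k : fieldType) (A : comAlgType k) (M : lmodType A)
    (D : A -> M) : Prop :=
  [/\ forall a b, D (a + b) = D a + D b,
      forall (c : k) a, D (c *: a) = (c%:A : A) *: D a &
      forall a b, D (a * b) = a *: D b + b *: D a].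

(* Kaehler differentials Omega_{A/k}.  An element of Omega_A is represented by
   a formal sum  sum_j a_j d(b_j)  (list of pairs (a_j, b_j)); every element
   of Omega_A is of this form.  Omega_A is the quotient of such formal sums by
   the kernel of the universal derivation, i.e. a formal sum is zero in
   Omega_A iff it is killed by every k-derivation D : A -> M into every
   A-module M. *)
Definition omega_zero (k : fieldType) (A : comAlgType k) (w : seq (A * A)) : Prop :=
  forall (M : lmodType A) (D : A -> M), kderivation D ->
    \sum_(p <- w) p.1 *: D p.2 = 0.

Definition omega_push (k : fieldType) (A B : comAlgType k) (f : A -> B)
    (w : seq (A * A)) : seq (B * B) :=
  map (fun p => (f p.1, f p.2)) w.

Definition in_tau (k : fieldType) (A : comAlgType k) (w : seq (A * A)) : Prop :=
  forall (B : comAlgType k), tame_PIA B ->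
    forall f : A -> B, kalg_hom f -> omega_zero (omega_push f w).

Definition tau_nonzero (k : fieldType) (A : comAlgType k) : Prop :=
  exists w : seq (A * A), in_tau w /\ ~ omega_zero w.

(* Main.v *)
(** Let [K = A/M].  Since [k] is perfect, [A] contains a copy of [K], so that
[A = K + V + M^2] for a complement [V] of [M^2] in [M], and [dim_K V >= 2]
because [A] is not a principal ideal algebra.

If [x y = 0] in [A], then [x dy] lies in [tau A]: in a tame
[L[s]/(s^n)], where [s^(n-1) ds = 0], the orders of the images of [x] and [y]
add up to at least [n].  As [M^3 = 0], this puts [x y dx] in [tau A] for
[x, y] in [M], and we may assume that all these elements vanish.

Then every [sum c_ij b_i db_j] with [sum c_ij b_i b_j = 0], where [b] is a
basis of [V], lies in [tau A].  For let [f : A -> L[s]/(s^n)] have order [a] on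
[V], with [2 a < n], and write [f(v) = phi(v) F + g(v)] with [F] of order [a],
[phi] valued in [L] and [g] of order [e > a].  If [a + e >= n], then [f] sends
the element to [(sum c_ij phi_i phi_j) F dF = 0].  Otherwise let [psi] be the
leading coefficient of [g]; then [v |-> phi(v) t + psi(v) z] is a tangent
vector, that is, an algebra map from [A] to [L[t,z]/(z^2, t^3, t^2 z)], and
the derivation [t d/dt - 2 z d/dz] of [L[t,z]/(z^2, t^3)], which kills
[t^2 z], pulls back to a derivation of [A] with values in the ideal [(t, z)]
that does not kill every [x y dx].

Finally some such element is nonzero.  If a relation has [c_01 <> c_10], it is
detected by an alternating form on [V].  If none has, the relation
[b_0 b_1 - b_1 b_0 = 0] shows that [K] has characteristic 2, and then the form
[(x, y) |-> xi_0(x) xi_1(y)] detects [b_0 db_1 - b_1 db_0]. *)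

From Stdlib Require Import Classical ClassicalEpsilon.
Require Import Defs.
From HB Require Import structures.
From mathcomp Require Import all_boot all_order all_algebra all_field.
From mathcomp Require Import ring zify.

Set Implicit Arguments.
Unset Strict Implicit.
Unset Printing Implicit Defensive.

Import GRing.Theory.
Local Open Scope ring_scope.

(** * Residue field and coefficient field *)

(** A nontrivial relation modulo [U] lets one spanning vector be dropped. Used with [U] zero for the
    dimension of the residue field, and with [U] the square of the maximal ideal to choose the
    complement of it. *)
Lemma basis_mod (F : fieldType) (V : lmodType F) (U P : V -> Prop) :
    (forall a u v, U u -> U v -> U (a *: u + v)) -> U 0 ->
    (exists s : seq V, (forall i : 'I_(size s), P s`_i) /\
      forall v, P v -> exists c : 'I_(size s) -> F, U (v - \sum_i c i *: s`_i)) ->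
  exists (n : nat) (b : 'I_n -> V),
    [/\ forall i, P (b i),
        forall v, P v -> exists c : 'I_n -> F, U (v - \sum_i c i *: b i) &
        forall c : 'I_n -> F, U (\sum_i c i *: b i) -> forall i, c i = 0].
Proof.
move=> Ulin U0 [s [Ps spans]].
have : exists b : 'I_(size s) -> V, (forall i, P (b i)) /\
    forall v, P v -> exists c : 'I_(size s) -> F, U (v - \sum_i c i *: b i).
  by exists (fun i => s`_i).
elim: (size s) => [|n IHn] [b [Pb spanb]].
  by exists 0, b; split=> // c _ [].
case: (classic (forall c : 'I_n.+1 -> F,
  U (\sum_i c i *: b i) -> forall i, c i = 0)) => [free|dep].
  by exists n.+1, b.
have [c [Uc [j cj]]] : exists c : 'I_n.+1 -> F,
    U (\sum_i c i *: b i) /\ exists j, c j != 0.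
  apply: NNPP => nc; apply: dep => c Uc i.
  by apply/eqP/negPn/negP => ci; apply: nc; exists c; split => //; exists i.
apply: IHn; exists (fun i => b (lift j i)); split=> // v /spanb[d Ud].
(* The vector [b j] is eliminated by means of the relation [c]. *)
exists (fun i => d (lift j i) - d j / c j * c (lift j i)).
have -> : v - \sum_i (d (lift j i) - d j / c j * c (lift j i)) *: b (lift j i)
    = (d j / c j) *: (\sum_i c i *: b i) + (v - \sum_i d i *: b i).
  rewrite (bigD1_ord j) //= [X in _ = _ + (_ - X)](bigD1_ord j) //=.
  under eq_bigr do rewrite scalerBl -scalerA.
  rewrite sumrB -scaler_sumr scalerDr scalerA mulfVK // opprB opprD.
  by rewrite [X in _ = X + _]addrC addrACA addNKr addrA [X in X - _]addrC.
exact: Ulin.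
Qed.

Lemma residue_field (k : fieldType) (A : comAlgType k) : local_alg A ->
  exists (K : fieldType) (rho : {rmorphism A -> K}),
    (forall y, exists x, rho x = y) /\ (forall x, rho x = 0 <-> nonunit x).
Proof.
case=> _ [M0 MD MM].
(* Quotients are taken by boolean ideals, hence the informative excluded middle. *)
pose I : {pred A} := fun x => if excluded_middle_informative (nonunit x)
  then true else false.
have IP x : reflect (nonunit x) (x \in I).
  rewrite unfold_in /I; case: excluded_middle_informative => ?; exact: ReflectT || exact: ReflectF.
have Icl : idealr_closed I.
  split; first exact/IP.
    by apply/IP; apply; exists 1; rewrite mulr1.
  by move=> a u v /IP Iu /IP Iv; apply/IP/MD => //; exact: MM.
pose mixI := isIdealr.Build A I Icl.
pose J : idealr A := HB.pack (I : A -> bool) mixI.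
pose Q : comNzRingType := {ideal_quot J}.
pose p : A -> Q := \pi_Q%qT.
have pP (x : A) : p x = 0 <-> nonunit x.
  rewrite /p -[0](rmorph0 (\pi_Q%qT : {rmorphism A -> Q})).
  split=> [/eqP|Mx]; last apply/eqP.
    by rewrite -Quotient.idealrBE subr0 => /IP.
  by rewrite -Quotient.idealrBE subr0; apply/IP.
have pK (y : Q) : exists x, p x = y by exists (repr y); rewrite /p reprK.
(* The last clause fixes the inverse of zero as the field structure prescribes it. *)
have inv (y : Q) : exists z : Q, (y != 0 -> z * y = 1) /\ (y = 0 -> z = 0).
  have [->|y0] := eqVneq y 0; first by exists 0.
  have [x xy] := pK y.
  have /NNPP[x' xx'] : ~ nonunit x by move/pP; rewrite xy => /eqP; rewrite (negPf y0).
  exists (p x'); split=> [_|/eqP]; last by rewrite (negPf y0).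
  by rewrite -xy /p -rmorphM /= mulrC xx' rmorph1.
have [i iP] := choice _ inv.
pose K : fieldType := HB.pack (Quotient.quot J) Q
  (GRing.ComNzRing_isField.Build Q (fun x => (iP x).1) ((iP 0).2 erefl)).
exists K, (p : {rmorphism A -> Q}); split=> //.
Qed.

(** [inhabited] turns the coordinate isomorphism, which is data, into a proposition. *)
Lemma vector_axiom (F : fieldType) (V : lmodType F) :
    (exists s : seq V, forall v, exists c : 'I_(size s) -> F, v = \sum_i c i *: s`_i) ->
  exists n, inhabited (Vector.axiom n V).
Proof.
case=> s spans.
have [||n [b [_ spanb freeb]]] := @basis_mod F V (fun v => v = 0) (fun=> True) _ erefl.
- by move=> a u v -> ->; rewrite scaler0 addr0.
- exists s; split=> // v _; have [c ->] := spans v.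
  by exists c; rewrite subrr.
have ex v : exists x : 'rV[F]_n, v = \sum_i x 0 i *: b i.
  have [c /eqP] := spanb v I; rewrite subr_eq0 => /eqP ->.
  by exists (\row_i c i); apply: eq_bigr => i _; rewrite mxE.
have [f fP] := choice _ ex.
have inj (x y : 'rV[F]_n) : \sum_i x 0 i *: b i = \sum_i y 0 i *: b i -> x = y.
  move/eqP; rewrite -subr_eq0 -sumrB.
  under eq_bigr do rewrite -scalerBl.
  move=> /eqP/freeb xy; apply/rowP => i.
  by apply/eqP; rewrite -subr_eq0; apply/eqP; apply: xy.
exists n; constructor; exists f.
  move=> a u v; apply: inj; rewrite -fP [in LHS](fP u) [in LHS](fP v).
  rewrite scaler_sumr -big_split /=.
  by apply: eq_bigr => i _; rewrite !mxE scalerDl scalerA.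
exists (fun x : 'rV[F]_n => \sum_i x 0 i *: b i) => [v|x]; first by rewrite -fP.
by apply: inj; rewrite -fP.
Qed.

(** Scalars act through [rho], and the image of a spanning family of [A] spans, so the residue field
    is finite over [k]. *)
Lemma residue_fieldExt (k : fieldType) (A : comAlgType k) :
    local_alg A -> finite_kalg A ->
  exists (K : fieldExtType k) (rho : {rmorphism A -> K}),
    [/\ forall c x, rho (c *: x) = c *: rho x,
        forall y, exists x, rho x = y & forall x, rho x = 0 <-> nonunit x].
Proof.
move=> locA [s spans]; have [K [rho [rho_surj rhoP]]] := residue_field locA.
pose scale (c : k) (y : K) := rho c%:A * y.
have sA a b v : scale a (scale b v) = scale (a * b) v.
  by rewrite /scale mulrA -rmorphM mulr_algl scalerA.
have s1 : left_id 1 scale by move=> v; rewrite /scale scale1r rmorph1 mul1r.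
have sDr : right_distributive scale +%R by move=> a u v; exact: mulrDr.
have sDl v : {morph scale^~ v : a b / a + b}.
  by move=> a b; rewrite /scale scalerDl rmorphD mulrDl.
pose L1 : lmodType k := HB.pack (GRing.Field.sort K) K
  (GRing.Zmodule_isLmodule.Build k K sA s1 sDr sDl).
have rhoZ c x : rho (c *: x) = (c *: (rho x : L1)) :> K.
  by rewrite /GRing.scale /= /scale -rmorphM mulr_algl.
have [n [ax]] : exists n, inhabited (Vector.axiom n L1).
  apply: vector_axiom; exists (map (rho : A -> L1) s) => v.
  have [x <-] := rho_surj v; have [c ->] := spans x.
  move: c; rewrite -(size_map (rho : A -> L1)) => c.
  exists c; rewrite raddf_sum /=; apply: eq_bigr => i _.
  by rewrite rhoZ (nth_map 0) // -(size_map (rho : A -> L1)).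
have sAl a u v : scale a (u * v) = scale a u * v by rewrite /scale mulrA.
pose L2 : lalgType k := HB.pack (GRing.Field.sort K) L1
  (GRing.Lmodule_isLalgebra.Build k L1 sAl).
have sAr a u v : scale a (u * v) = u * scale a v by rewrite /scale mulrCA.
pose L : fieldExtType k := HB.pack (GRing.Field.sort K) L2
  (GRing.Lalgebra_isAlgebra.Build k L2 sAr)
  (Lmodule_hasFinDim.Build k L1 ax).
by exists L, (rho : {rmorphism A -> K}).
Qed.

(** An inseparable minimal polynomial is some [g0] evaluated at the [p]-th power of the variable.
    Taking [p]-th roots of the coefficients of [g0] gives [h] with [h(x)^p = 0], so [x] is a root of
    a polynomial of too small a degree. *)
Lemma perfect_separable (k : fieldType) (L : fieldExtType k) :
  perfect_field k -> forall x : L, separable_element 1 x.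
Proof.
move=> perf x; apply/negPn/negP => /separablePn_pchar[p pL [g /polyOver1P[g0 ->] mx]].
have pk : p \in [pchar k] by rewrite -(pchar_lalg L).
have [r rP] := choice _ (perf p pk).
pose h := \poly_(i < size g0) r g0`_i.
have szh : (size h <= size g0)%N by exact: size_poly.
have sz (q : {poly k}) : size (map_poly (in_alg L) q) = size q.
  by rewrite size_map_poly.
have hx : root (map_poly (in_alg L) h) x.
  have : pFrobenius_aut pL (map_poly (in_alg L) h).[x] = 0.
    rewrite (@horner_coef_wide _ (size g0)) ?sz // rmorph_sum /=.
    have := root_minPoly 1 x; rewrite mx rootE horner_comp hornerXn.
    rewrite (@horner_coef_wide _ (size g0)) ?sz // => /eqP mg0; rewrite -[RHS]mg0.
    apply: eq_bigr => i _; rewrite rmorphM /= !pFrobenius_autE !coef_map coef_poly.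
    by rewrite ltn_ord /= -in_algE -rmorphXn /= rP -!exprM mulnC.
  by move/eqP; rewrite fmorph_eq0.
have szm : (size (minPoly 1 x)).-1 = ((size g0).-1 * p)%N.
  by rewrite mx size_comp_poly size_polyXn sz.
have m_gt1 : (1 < size (minPoly 1 x))%N.
  by rewrite size_minPoly.
have p_gt1 := prime_gt1 (pcharf_prime pk).
have g0N0 : g0 != 0.
  by apply: contraTneq m_gt1 => g00; rewrite mx g00 map_poly0 comp_poly0 size_poly0.
(* The [p]-th power of the top coefficient of [h] is the leading coefficient of [g0]. *)
have hN0 : h != 0.
  apply/eqP => h0; move: (g0N0); apply/negP/negPn; rewrite -lead_coef_eq0 lead_coefE -[_`__]rP.
  have : h`_(size g0).-1 = r g0`_(size g0).-1.
    by rewrite coef_poly ltn_predL size_poly_gt0 g0N0.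
  by rewrite h0 coef0 => <-; rewrite expr0n; rewrite gtn_eqF // ltnW.
have /dvdp_leq : minPoly 1 x %| map_poly (in_alg L) h.
  by apply: minPoly_dvdp => //; apply/polyOver1P; exists h.
rewrite map_poly_eq0 sz => /(_ hN0).
have := leq_mul (leqnn (size g0).-1) p_gt1.
by rewrite -szm; move: m_gt1 szh; set a := size (minPoly _ _); set b := size h; lia.
Qed.

Lemma taylor2 (R : comNzRingType) (p : {poly R}) (x h : R) :
  exists r, p.[x + h] = p.[x] + p^`().[x] * h + r * h ^+ 2.
Proof.
elim/poly_ind: p => [|p c [r IHp]].
  by exists 0; rewrite deriv0 !horner0 !mul0r !addr0.
exists (r * x + r * h + p^`().[x]).
by rewrite derivMXaddC !hornerMXaddC hornerD hornerMX IHp; ring.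
Qed.

(** With [u] inverse to the derivative, the linear Taylor term cancels [p.[x]] and the error is
    squared. *)
Lemma newton_step (R : comNzRingType) (p : {poly R}) (x u : R) :
  p^`().[x] * u = 1 -> exists r, p.[x - p.[x] * u] = r * p.[x] ^+ 2.
Proof.
move=> xu; have [r ->] := taylor2 p x (- (p.[x] * u)).
exists (r * u ^+ 2); transitivity (p.[x] * (1 - p^`().[x] * u) + r * u ^+ 2 * p.[x] ^+ 2).
  by ring.
by rewrite xu subrr mulr0 add0r.
Qed.

Lemma separable_generator_poly (k : fieldType) (L : fieldExtType k) :
    perfect_field k ->
  exists (x : L) (p : {poly k}),
    [/\ horner_alg x p = 0, horner_alg x p^`() != 0,
        forall q, horner_alg x q = 0 -> p %| q &
        forall y, exists q, horner_alg x q = y].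
Proof.
move=> perf; pose x := separable_generator 1%AS (fullv : {vspace L}).
have genE : <<1; x>>%VS = fullv.
  apply/esym/eq_adjoin_separable_generator; last exact: subvf.
  by apply/separableP => y _; apply: perfect_separable.
have /polyOver1P[p mp] := minPolyOver 1 x.
exists x, p; split.
- by have := root_minPoly 1 x; rewrite mp => /eqP.
- have := separable_root_der 1 x; rewrite (perfect_separable perf) /=.
  by rewrite mp deriv_map.
- move=> q qx0; rewrite -(dvdp_map (in_alg L)) -mp minPoly_dvdp //.
    by apply/polyOver1P; exists q.
  exact/eqP.
- move=> y; have /Fadjoin_polyP[_ /polyOver1P[q ->] ->] : y \in <<1; x>>%VS.
    by rewrite genE memvf.
  by exists q.
Qed.

(** Hensel lifting of a primitive element [x] of [K]. If [a] lifts [x] and [m = p(a)], two Newton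
    steps leave an error divisible by [m^4], which is zero because [m] lies in the maximal ideal.
    The resulting root [e] of [p] defines [tau] by sending [x] to [e]. *)
Lemma coefficient_field (k : fieldType) (A : comAlgType k) (K : fieldExtType k)
    (rho : {rmorphism A -> K}) :
    perfect_field k ->
    (forall c x, rho (c *: x) = c *: rho x) -> (forall y, exists x, rho x = y) ->
    (forall x, rho x != 0 -> exists y, x * y = 1) ->
    (forall x y z, rho x = 0 -> rho y = 0 -> rho z = 0 -> x * y * z = 0) ->
  exists tau : {rmorphism K -> A},
    (forall c y, tau (c *: y) = c *: tau y) /\ (forall y, rho (tau y) = y).
Proof.
move=> perf rhoZ rho_surj rho_unit cube0.
have [x [p [px0 dpx0 pmin xgen]]] := separable_generator_poly K perf.
have rho_alg q a : rho (horner_alg a q) = horner_alg (rho a) q.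
  elim/poly_ind: q => [|q c IHq]; first by rewrite !rmorph0.
  by rewrite !rmorphD !rmorphM /= !horner_algC !horner_algX IHq rhoZ rmorph1.
have [a xa] := rho_surj x.
have newton b : rho b = x -> exists b', rho b' = x /\
    exists s : A, horner_alg b' p = s * horner_alg b p ^+ 2.
  move=> xb; have [|u bu] := rho_unit (horner_alg b p^`()).
    by rewrite rho_alg xb.
  exists (b - horner_alg b p * u); split.
    by rewrite rmorphB rmorphM /= rho_alg xb px0 mul0r subr0.
  by apply: (@newton_step _ (map_poly (in_alg A) p)); rewrite deriv_map.
have [b [xb [s1 bs1]]] := newton a xa.
have [e [xe [s2 es2]]] := newton b xb.
have {bs1 es2} pe0 : horner_alg e p = 0.
  have m0 : rho (horner_alg a p) = 0 by rewrite rho_alg xa.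
  rewrite es2 bs1; set m := horner_alg a p in m0 *.
  have -> : s2 * (s1 * m ^+ 2) ^+ 2 = s2 * s1 ^+ 2 * m * (m * m * m).
    ring.
  by rewrite (cube0 m m m) ?mulr0.
have kere q : horner_alg x q = 0 -> horner_alg e q = 0.
  by move/pmin/dvdpP => [r ->]; rewrite rmorphM /= pe0 mulr0.
have [q qP] := choice _ xgen.
(* The value at [e] is independent of the polynomial representing [y], so the arbitrary choice [q]
   still gives a ring morphism. *)
have tauP r y : horner_alg x r = y -> horner_alg e (q y) = horner_alg e r.
  move=> ry; apply/eqP; rewrite -subr_eq0 -rmorphB; apply/eqP/kere.
  by rewrite rmorphB /= qP ry subrr.
pose tau y := horner_alg e (q y).
have tauB : zmod_morphism tau.
  by move=> y z; rewrite -[RHS]rmorphB; apply: tauP; rewrite rmorphB /= !qP.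
have tauM : monoid_morphism tau.
  split=> [|y z].
    by rewrite -[RHS](rmorph1 (horner_alg e)); apply: tauP; rewrite rmorph1.
  by rewrite -[RHS]rmorphM; apply: tauP; rewrite rmorphM /= !qP.
pose T : {rmorphism K -> A} := HB.pack tau
  (GRing.isZmodMorphism.Build K A tau tauB) (GRing.isMonoidMorphism.Build K A tau tauM).
exists T; split=> [c y|y]; last by rewrite rho_alg xe qP.
have -> : c *: T y = horner_alg e (c%:P * q y).
  by rewrite rmorphM /= horner_algC mulr_algl.
by apply: tauP; rewrite rmorphM /= horner_algC mulr_algl qP.
Qed.

(** * Orders of vanishing in [L[s]] *)

Lemma dvdXnP (L : fieldType) n (p : {poly L}) :
  reflect (forall i, (i < n)%N -> p`_i = 0) ('X^n %| p).
Proof.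
apply: (iffP idP) => [/dvdpP[q ->] i lin|p0]; first by rewrite coefMXn lin.
rewrite -(poly_take_drop n p) (_ : take_poly n p = 0) ?add0r ?dvdp_mull //.
by apply/polyP => i; rewrite coef_take_poly coef0; case: ltnP => // /p0.
Qed.

Lemma dvdXn_deriv (L : fieldType) n (p : {poly L}) : 'X^n %| p -> 'X^(n.-1) %| p^`().
Proof.
move/dvdXnP => p0; apply/dvdXnP => i ltin; rewrite coef_deriv p0 ?mul0rn //.
by case: n ltin {p0}.
Qed.

(** Since ['X] is prime, each of its [n] copies can be cancelled from one of the two factors. *)
Lemma dvdXn_factor (L : fieldType) n (p q : {poly L}) : 'X^n %| p * q ->
  exists c d, [/\ (c + d)%N = n, 'X^c %| p & 'X^d %| q].
Proof.
elim: n p q => [|n IHn] p q pq; first by exists 0, 0; rewrite !dvd1p.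
have X0 : 'X%R = 'X - (0 : L)%:P by rewrite subr0.
have : root (p * q) 0.
  by rewrite -dvdp_XsubCl -X0 (dvdp_trans _ pq) // -[X in X %| _]expr1 dvdp_exp2l.
rewrite rootM -!dvdp_XsubCl -X0 => /orP[] /dvdpP[r rE].
  have /IHn[c [d [<- cr dq]]] : 'X^n %| r * q.
    by move: pq; rewrite rE mulrAC exprSr dvdp_mul2r ?polyX_eq0.
  by exists c.+1, d; rewrite rE exprSr dvdp_mul ?dvdpp.
have /IHn[c [d [<- cp dr]]] : 'X^n %| p * r.
  by move: pq; rewrite rE mulrA exprSr dvdp_mul2r ?polyX_eq0.
by exists c, d.+1; rewrite rE exprSr dvdp_mul ?dvdpp // addnS.
Qed.

Lemma dvdXn_mul (L : fieldType) a b n (p q : {poly L}) :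
  'X^a %| p -> 'X^b %| q -> (n <= a + b)%N -> 'X^n %| p * q.
Proof.
by move=> ap bq nab; rewrite (dvdp_trans (dvdp_exp2l _ nab)) // exprD dvdp_mul.
Qed.

(** Differentiating lowers an order by at most one. This is why [x dy] dies in a tame truncated
    polynomial ring when [x y = 0]. *)
Lemma dvdXn_mul_deriv (L : fieldType) n (p q : {poly L}) :
  'X^n %| p * q -> 'X^(n.-1) %| p * q^`().
Proof.
case/dvdXn_factor => c [d [<- cp /dvdXn_deriv dq]].
by apply: dvdXn_mul cp dq _; lia.
Qed.

Lemma dvdp_sumr (L : fieldType) (I : finType) (d : {poly L}) (F : I -> {poly L}) :
  (forall i, d %| F i) -> d %| \sum_i F i.
Proof.
move=> dF; apply: (big_ind (fun p => d %| p)) => [|p q|//]; first exact: dvdp0.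
exact: dvdp_add.
Qed.

(** Capping the order at [n] makes the minimum exist even if all [P i] vanish. *)
Lemma common_order (L : fieldType) (I : finType) n (P : I -> {poly L}) :
  exists a, (forall i, 'X^a %| P i) /\ ((n <= a)%N \/ exists i, (P i)`_a != 0).
Proof.
have ex : exists a, (n <= a)%N || [exists i, (P i)`_a != 0] by exists n; rewrite leqnn.
have [a aP amin] := ex_minnP ex; exists a; split; last first.
  by case/orP: aP => [|/existsP]; [left|right].
move=> i; apply/dvdXnP => j ltja; apply/eqP; apply: contraTT ltja => Pij.
by rewrite -leqNgt amin //; apply/orP; right; apply/existsP; exists i.
Qed.

(** Here [P i] is the image of a basis element and [rel] holds the relations modulo ['X^n]. Either
    all their differentials are divisible by ['X^(n.-1)], hence zero, or leading coefficients give a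
    tangent vector [phi t + psi z]. In the proof the remainders [g] have common order
    [b = a + e]. *)
Lemma quadric_dichotomy (L : fieldType) (r n : nat) (P : 'I_r -> {poly L})
    (rel := fun c : 'I_r * 'I_r -> L => 'X^n %| \sum_p (c p)%:P * (P p.1 * P p.2)) :
  (forall c, rel c -> 'X^(n.-1) %| \sum_p (c p)%:P * (P p.1 * (P p.2)^`())) \/
  exists (phi psi : 'I_r -> L) (i j : 'I_r),
    [/\ phi i != 0, psi i = 0, psi j != 0 &
      forall c, rel c -> \sum_p c p * (phi p.1 * phi p.2) = 0 /\
        \sum_p c p * (phi p.1 * psi p.2 + psi p.1 * phi p.2) = 0].
Proof.
have [a [aP a_or]] := common_order n P.
have [n2a|lt2an] := leqP n (a + a).
  left=> c _; apply: dvdp_sumr => p.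
  by rewrite dvdp_mull // (dvdXn_mul (aP _) (dvdXn_deriv (aP _))) //; lia.
have [i0 Pi0] : exists i, (P i)`_a != 0.
  by case: a_or => // na; move: lt2an na; lia.
(* This normalization gives [phi i0 = 1], so [g i0 = 0] and later [psi i0 = 0]. *)
pose phi i := (P i)`_a / (P i0)`_a.
have phi1 : phi i0 = 1 by rewrite /phi mulfV.
pose g i := P i - (phi i)%:P * P i0.
have PE i : P i = (phi i)%:P * P i0 + g i by rewrite addrC subrK.
have ga1 i : 'X^(a.+1) %| g i.
  apply/dvdXnP => j; rewrite ltnS leq_eqVlt coefB coefCM => /orP[/eqP->|ltja].
    by rewrite /phi divfK ?subrr.
  have /dvdXnP Pa := aP i; have /dvdXnP Pa0 := aP i0.
  by rewrite Pa // Pa0 // mulr0 subr0.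
have [b [bP b_or]] := common_order n g.
have [e [be e0]] : exists e, b = (a + e)%N /\ (0 < e)%N.
  suff ltab : (a < b)%N by exists (b - a)%N; split; lia.
  case: b_or => [|[i]]; first lia.
  by rewrite ltnNge; apply: contraNN => leba; apply/eqP/(dvdXnP _ _ (ga1 i)).
have /dvdpP[F0 F0E] := aP i0.
have [G GE] := choice (fun i G => g i = G * 'X^b) (fun i => dvdpP _ _ (bP i)).
have F00 : F0.[0] != 0 by move: Pi0; rewrite F0E coefMXn ltnn subnn -horner_coef0.
have G0 i : (G i).[0] = (g i)`_b by rewrite GE coefMXn ltnn subnn -horner_coef0.
pose T c := \sum_p (c p)%:P * ((phi p.1)%:P * G p.2 + (phi p.2)%:P * G p.1).
pose U c := \sum_p (c p)%:P * (G p.1 * G p.2).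
(* The form in [phi] alone appears in degree [2 a], the one polarized between [phi] and [psi] in
   degree [a + b]. *)
have PPE c : \sum_p (c p)%:P * (P p.1 * P p.2) =
   ((\sum_p c p * (phi p.1 * phi p.2))%:P * F0 ^+ 2 + 'X^e * (F0 * T c + 'X^e * U c)) * 'X^(a + a).
  rewrite rmorph_sum /= /T /U !mulr_sumr mulr_suml -big_split /= mulr_sumr -big_split /=.
  rewrite mulr_suml; apply: eq_bigr => p _.
  rewrite (PE p.1) (PE p.2) F0E !GE be !exprD !rmorphM /=; ring.
have Xn0 m : 'X^m != 0 :> {poly L} by rewrite expf_neq0 ?polyX_eq0.
have rel2 c : rel c -> \sum_p c p * (phi p.1 * phi p.2) = 0.
  rewrite /rel PPE => dvdn.
  (* As [2 a < n], the coefficient in degree [2 a] vanishes, and [F0] has nonzero constant term. *)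
  have /dvdpP[q] : 'X^(1 + (a + a)) %| \sum_p (c p)%:P * (P p.1 * P p.2).
    by rewrite PPE (dvdp_trans _ dvdn) // dvdp_exp2l.
  rewrite PPE (exprD _ 1) expr1 [RHS]mulrA => /(mulIf (Xn0 _)).
  move/(congr1 (horner^~ 0)); rewrite !(hornerE, hornerXn) expr0n gtn_eqF // ?(mul0r, addr0, mulr0).
  by move/eqP; rewrite !mulf_eq0 ?expf_eq0 /= (negPf F00) !orbF => /eqP.
(* If [n <= a + b], the main term is [rel2] times [P i0] times its derivative, and all other terms
   have order at least [a + b - 1]. *)
have [nab|ltab] := leqP n (a + b); [left=> c relc|right].
  rewrite (eq_bigr (fun p => (c p * (phi p.1 * phi p.2))%:P * (P i0 * (P i0)^`()) +
    (c p)%:P * ((phi p.1)%:P * (P i0 * (g p.2)^`()) +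
      (phi p.2)%:P * (g p.1 * (P i0)^`()) + g p.1 * (g p.2)^`()))); last first.
    move=> p _; rewrite {1}(PE p.1) {1}(PE p.2) derivD derivM derivC !rmorphM /=; ring.
  rewrite big_split /= -mulr_suml -rmorph_sum rel2 // mul0r add0r.
  apply: dvdp_sumr => p; apply/dvdp_mull/dvdp_add; first (apply: dvdp_add; apply: dvdp_mull).
  - by apply: (dvdXn_mul (aP _) (dvdXn_deriv (bP _))); lia.
  - by apply: (dvdXn_mul (bP _) (dvdXn_deriv (aP _))); lia.
  - by apply: (dvdXn_mul (bP _) (dvdXn_deriv (bP _))); lia.
exists phi, (fun i => (g i)`_b), i0.
case: b_or => [|[j gj]]; first lia.
exists j; split=> //; first by rewrite phi1 oner_eq0.
  by rewrite /g phi1 mul1r subrr coef0.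
move=> c relc; split; first exact: rel2.
move: (relc); rewrite /rel PPE rel2 // polyC0 mul0r add0r => dvdn.
(* As [a + b < n], the coefficient in degree [a + b] vanishes; [U c] does not reach it because
   [e > 0]. *)
have : 'X^(1 + (a + b)) %| 'X^e * (F0 * T c + 'X^e * U c) * 'X^(a + a).
  by rewrite (dvdp_trans _ dvdn) // dvdp_exp2l.
rewrite (_ : 1 + (a + b) = e.+1 + (a + a))%N; last lia.
rewrite exprD dvdp_mul2r // exprSr dvdp_mul2l // => /dvdpP[q].
move/(congr1 (horner^~ 0)); rewrite !(hornerE, hornerXn) expr0n gtn_eqF // ?(mul0r, addr0, mulr0).
move/eqP; rewrite mulf_eq0 (negPf F00) /= => /eqP.
rewrite /T horner_sum => T0; rewrite -[RHS]T0; apply: eq_bigr => p _.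
by rewrite hornerM hornerD !hornerM !hornerC !G0; ring.
Qed.

(** * Differentials of tame principal ideal algebras *)

(** Constants [y] of [L] have differential zero: with [q] the separable minimal polynomial of [y],
    [q'(y) dy = 0] and [q'(y)] is invertible. The map [lam] need not be unital, because it will be
    the inclusion of one factor of a product. *)
Lemma poly_derivation (k : fieldType) (L : fieldExtType k) (B : comNzRingType)
    (M : lmodType B) (lam : {poly L} -> B) (del : {poly L} -> M) :
    perfect_field k ->
    (forall P Q, lam (P + Q) = lam P + lam Q) ->
    (forall P Q, lam (P * Q) = lam P * lam Q) ->
    (forall P Q, del (P + Q) = del P + del Q) ->
    (forall P Q, del (P * Q) = lam P *: del Q + lam Q *: del P) ->
    (forall c : k, del (c%:A)%:P = 0) -> (forall P, lam 1 *: del P = del P) ->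
  forall P, del P = lam P^`() *: del 'X.
Proof.
move=> perf lamD lamM delD delM delk lam1.
have lam0 : lam 0 = 0 by apply: (addrI (lam 0)); rewrite -lamD !addr0.
have del_alg (y : L) q : del ((map_poly (in_alg L) q).[y])%:P =
    lam ((map_poly (in_alg L) q^`()).[y])%:P *: del y%:P.
  elim/poly_ind: q => [|q c IHq].
    by rewrite deriv0 !rmorph0 !horner0 lam0 scale0r -(delk 0) scale0r.
  rewrite derivMXaddC !rmorphD !rmorphM /= map_polyX map_polyC /= hornerMXaddC hornerD hornerMX.
  rewrite !rmorphD !rmorphM /= delD delM delk addr0 IHq lamD lamM scalerDl scalerA.
  by rewrite [lam _ * _]mulrC.
have delC (y : L) : del y%:P = 0.
  have := perfect_separable perf y; have /polyOver1P[q mq] := minPolyOver 1 y.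
  have := separable_root_der 1 y => /[swap] -> /=; rewrite mq deriv_map rootE => dqy.
  have := del_alg y q; have := root_minPoly 1 y; rewrite mq rootE => /eqP ->.
  rewrite -[in LHS](scale0r (1 : L)) delk.
  move/(congr1 ( *:%R (lam (((map_poly (in_alg L) q^`()).[y])^-1)%:P))).
  by rewrite scaler0 scalerA -lamM -polyCM mulVf // lam1.
elim/poly_ind => [|P c IHP].
  by rewrite deriv0 lam0 scale0r -polyC0 delC.
rewrite derivMXaddC delD delM delC addr0 IHP scalerA -lamM lamD scalerDl.
by rewrite [_ * 'X]mulrC.
Qed.

(** On each factor the form becomes [h ds] with [h] divisible by [s^(n-1)], and [s^(n-1) ds = 0]
    since [0 = d(s^n) = n s^(n-1) ds] with [n] invertible. *)
Lemma omega_zero_tame (k : fieldType) (B : comAlgType k) (m : nat)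
    (K : 'I_m -> fieldExtType k) (n : 'I_m -> nat)
    (pi : forall i : 'I_m, B -> trunc_poly (K i) (n i)) :
    perfect_field k ->
    (forall i, (0 < n i)%N) -> (forall i, tame_trunc (K i) (n i)) ->
    (forall i, [/\ forall a b, pi i (a + b) = pi i a + pi i b,
                   forall a b, pi i (a * b) = pi i a * pi i b,
                   pi i 1 = 1 &
                   forall (c : k) a, pi i (c *: a) = (c%:A : K i) *: pi i a]) ->
    (forall b b' : B, (forall i, pi i b = pi i b') -> b = b') ->
    (forall t : forall i : 'I_m, trunc_poly (K i) (n i),
       exists b : B, forall i, pi i b = t i) ->
  forall w : seq (B * B),
    (forall i, 'X^((n i).-1) %| \sum_(p <- w) (pi i p.1 : {poly _}) * (pi i p.2 : {poly _})^`()) ->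
  omega_zero w.
Proof.
move=> perf n_gt0 tame piP inj surj w wP M D [DD DZ DM].
have piD i := let: And4 h _ _ _ := piP i in h.
have piM i := let: And4 _ h _ _ := piP i in h.
have pi1 i := let: And4 _ _ h _ := piP i in h.
have piZ i := let: And4 _ _ _ h := piP i in h.
have pi0 i : pi i 0 = 0 by apply: (addrI (pi i 0)); rewrite -piD !addr0.
(* Extension by zero from the [i]-th factor; [lam i 1] is the corresponding idempotent. *)
have exlam i (P : {poly K i}) : exists b, pi i b = in_qpoly 'X^(n i) P /\
    forall j, j != i -> pi j b = 0.
  have [b bP] := surj (dfwith (fun j => 0 : trunc_poly (K j) (n j)) (in_qpoly 'X^(n i) P)).
  by exists b; split=> [|j ji]; rewrite bP ?dfwith_in // dfwith_out // eq_sym.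
pose lam i P := proj1_sig (constructive_indefinite_description _ (exlam i P)).
have lamE i P : pi i (lam i P) = in_qpoly 'X^(n i) P.
  by rewrite /lam; case: constructive_indefinite_description => b [].
have lam_out i j P : j != i -> pi j (lam i P) = 0.
  by rewrite /lam; case: constructive_indefinite_description => b []; auto.
have lam_eq i P b : pi i b = in_qpoly 'X^(n i) P -> (forall j, j != i -> pi j b = 0) ->
    lam i P = b.
  move=> bi bj; apply: inj => j; have [->|ji] := eqVneq j i; first by rewrite lamE bi.
  by rewrite lam_out ?bj.
have lamD i P Q : lam i (P + Q) = lam i P + lam i Q.
  by apply: lam_eq => [|j ji]; rewrite piD ?lamE ?raddfD //= !lam_out ?addr0.
have lamM i P Q : lam i (P * Q) = lam i P * lam i Q.
  by apply: lam_eq => [|j ji]; rewrite piM ?lamE ?rmorphM //= !lam_out ?mulr0.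
have lamX i : lam i 'X^(n i) = 0.
  apply: lam_eq => *; rewrite pi0 //; apply/val_inj => /=.
  by rewrite mk_monic_Xn prednK // Pdiv.RingMonic.rmodpp ?monicXn.
have lamk i (c : k) : lam i (c%:A)%:P = c *: lam i 1.
  apply: lam_eq => [|j ji]; rewrite piZ ?lamE; last by rewrite lam_out ?scaler0.
  by rewrite -linearZ /= alg_polyC.
have lam_pi i b : lam i 1 * b = lam i (pi i b).
  apply/esym/lam_eq => [|j ji]; rewrite piM ?lamE ?lam_out ?mul0r //.
  rewrite rmorph1 mul1r; apply/val_inj.
  exact/esym/in_qpoly_small/size_mk_monic.
have lam_sum : \sum_i lam i 1 = 1.
  apply: inj => j; rewrite (big_morph _ (piD j) (pi0 j)) (bigD1 j) //= big1 ?addr0.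
    by rewrite lamE pi1 rmorph1.
  by move=> i ij; rewrite lam_out // eq_sym.
rewrite -[LHS]scale1r -lam_sum scaler_suml big1 // => i _.
set e := lam i 1; have ee : e * e = e by rewrite -lamM mulr1.
(* Differentiating [e = e * e] and multiplying by [e] gives [e De = 2 e De]. *)
have eDe : e *: D e = 0.
  have : e *: D e = e *: D e + e *: D e.
    by rewrite -{2}ee DM scalerDr scalerA ee.
  by move/(congr1 (fun z => z - e *: D e)); rewrite subrr addrK => <-.
pose del P := e *: D (lam i P).
have elam P : e * lam i P = lam i P by rewrite -lamM mul1r.
have delP := @poly_derivation k (K i) B M (lam i) del perf (lamD i) (lamM i).
have {}delP P : del P = lam i P^`() *: del 'X.
  apply: delP => [P' Q|P' Q|c|P'].
  - by rewrite /del lamD DD scalerDr.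
  - by rewrite /del lamM DM scalerDr !scalerA mulrC [e * lam i Q]mulrC.
  - by rewrite /del lamk DZ scalerA mulrC -scalerA eDe scaler0.
  - by rewrite /del scalerA ee.
(* Tameness enters here: [n i] is invertible in [K i]. *)
have lamX1 : lam i ('X^((n i).-1)) *: del 'X = 0.
  have : del 'X^(n i) = 0.
    have D0 : D 0 = 0 by apply: (addrI (D 0)); rewrite -DD !addr0.
    by rewrite /del lamX D0 scaler0.
  rewrite delP derivXn.
  have nN0 : (n i)%:R != 0 :> K i.
    rewrite natf_neq0_pchar; apply/pnatP => // p _ pn; rewrite inE /=.
    by apply: contraL pn => /tame.
  rewrite -mulr_natl -polyC_natr lamM.
  move/(congr1 ( *:%R (lam i ((n i)%:R^-1)%:P))).
  by rewrite scaler0 scalerA mulrA -lamM -polyCM mulVf // elam.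
have eD b : e *: D b = del (pi i b).
  rewrite /del -lam_pi -/e DM scalerDr !scalerA ee [e * b]mulrC -scalerA eDe scaler0.
  by rewrite addr0.
have eS b b' : e *: (b *: D b') = lam i ((pi i b : {poly _}) * (pi i b' : {poly _})^`()) *: del 'X.
  rewrite lamM -scalerA -delP -eD -lam_pi -/e !scalerA.
  by rewrite mulrAC ee.
rewrite scaler_sumr; under eq_bigr do rewrite eS.
rewrite -scaler_suml.
have lam0 : lam i 0 = 0 by apply: (addrI (lam i 0)); rewrite -lamD !addr0.
rewrite -(big_morph _ (lamD i) lam0); have /dvdpP[q ->] := wP i.
by rewrite lamM -scalerA lamX1 scaler0.
Qed.

(** * Derivations on the graded algebra [K + V + M^2] *)

(** Allows a test module to be given by explicit formulas for the action on a group of tuples. *)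
Lemma omega_zero_action (k : fieldType) (A : comAlgType k) (V : zmodType)
    (act : A -> V -> V) (D : A -> V) (w : seq (A * A)) :
    (forall a b v, act a (act b v) = act (a * b) v) -> (forall v, act 1 v = v) ->
    (forall a u v, act a (u + v) = act a u + act a v) ->
    (forall v a b, act (a + b) v = act a v + act b v) ->
    (forall a b, D (a + b) = D a + D b) -> (forall (c : k) a, D (c *: a) = act c%:A (D a)) ->
    (forall a b, D (a * b) = act a (D b) + act b (D a)) ->
  omega_zero w -> \sum_(p <- w) act p.1 (D p.2) = 0.
Proof.
case: V act D => V mV act D actA act1 actDr actDl DD DZ DM w0.
pose M : lmodType A := HB.pack V (GRing.Zmodule.Pack mV)
  (GRing.Zmodule_isLmodule.Build A (GRing.Zmodule.Pack mV) actA act1 actDr actDl).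
by apply: (w0 M D); split.
Qed.

Section Coordinates.

Variables (k : fieldType) (A : comAlgType k) (K : fieldExtType k).
Variables (rho : {rmorphism A -> K}) (tau : {rmorphism K -> A}).
(** The products [b i * b j] may be dependent, so [cw] is only a choice of coefficients and need not
    be additive; what is canonical is its image under [quad]. *)
Variables (r : nat) (b : 'I_r -> A) (xi : 'I_r -> A -> K) (cw : A -> 'I_r * 'I_r -> K).

Let lin (c : 'I_r -> K) : A := \sum_i tau (c i) * b i.
Let quad (c : 'I_r * 'I_r -> K) : A := \sum_p tau (c p) * (b p.1 * b p.2).

Hypotheses (tauZ : forall c y, tau (c *: y) = c *: tau y) (tauK : forall y, rho (tau y) = y).
Hypothesis cube0 : forall x y z, rho x = 0 -> rho y = 0 -> rho z = 0 -> x * y * z = 0.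
Hypothesis rho_b : forall i, rho (b i) = 0.
Hypothesis decomp : forall a,
  a = tau (rho a) + \sum_i tau (xi i a) * b i + \sum_p tau (cw a p) * (b p.1 * b p.2).
Hypothesis free : forall c d,
  \sum_i tau (c i) * b i + \sum_p tau (d p) * (b p.1 * b p.2) = 0 -> forall i, c i = 0.

Lemma rho_lin c : rho (lin c) = 0.
Proof. by rewrite rmorph_sum big1 // => i _; rewrite rmorphM /= rho_b mulr0. Qed.

Lemma rho_quad c : rho (quad c) = 0.
Proof. by rewrite rmorph_sum big1 // => i _; rewrite !rmorphM /= rho_b mul0r mulr0. Qed.

Lemma linB c d : lin c - lin d = lin (fun i => c i - d i).
Proof. by rewrite /lin -sumrB; apply: eq_bigr => i _; rewrite rmorphB mulrBl. Qed.

Lemma quadB c d : quad c - quad d = quad (fun p => c p - d p).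
Proof. by rewrite /quad -sumrB; apply: eq_bigr => p _; rewrite rmorphB mulrBl. Qed.

(** Applying [rho] isolates [y], and freeness of the [b i] modulo the span of their products
    isolates [c]. *)
Lemma coord_unique a y c d : a = tau y + lin c + quad d ->
  [/\ rho a = y, forall i, xi i a = c i & quad (cw a) = quad d].
Proof.
move=> aE; have ya : rho a = y.
  by rewrite aE !rmorphD /= rho_lin rho_quad tauK !addr0.
have := decomp a; rewrite {1}aE -ya -!addrA => /addrI/eqP.
rewrite eq_sym -subr_eq0 opprD addrACA linB quadB => /eqP cd0.
have ca i : xi i a = c i by apply/eqP; rewrite -subr_eq0; apply/eqP/(free cd0).
split=> //; apply/eqP; rewrite -subr_eq0 quadB -cd0 [X in X + _]big1 ?add0r // => i _.
by rewrite ca subrr rmorph0 mul0r.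
Qed.

Lemma coordD a a' :
  [/\ rho (a + a') = rho a + rho a', forall i, xi i (a + a') = xi i a + xi i a' &
     quad (cw (a + a')) = quad (fun p => cw a p + cw a' p)].
Proof.
apply: coord_unique; rewrite {1}(decomp a) {1}(decomp a') /lin /quad rmorphD.
under [in RHS]eq_bigr do rewrite rmorphD mulrDl.
under [X in _ = _ + X]eq_bigr do rewrite rmorphD mulrDl.
rewrite !big_split /=; ring.
Qed.

Lemma coordZ (c : k) a :
  [/\ rho (c *: a) = c *: rho a, forall i, xi i (c *: a) = c *: xi i a &
     quad (cw (c *: a)) = quad (fun p => c *: cw a p)].
Proof.
apply: coord_unique; rewrite {1}(decomp a) /lin /quad tauZ !scalerDr !scaler_sumr.
by congr (_ + _ + _); apply: eq_bigr => i _; rewrite tauZ scalerAl.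
Qed.

Lemma mul_lin c c' : lin c * lin c' = quad (fun p => c p.1 * c' p.2).
Proof.
rewrite /lin /quad big_distrlr /= pair_bigA /=; apply: eq_bigr => p _.
by rewrite rmorphM; ring.
Qed.

Lemma mul_quad x c : rho x = 0 -> x * quad c = 0.
Proof.
move=> x0; rewrite mulr_sumr big1 // => p _.
by rewrite mulrCA [x * (_ * _)]mulrA cube0 ?mulr0 ?rho_b.
Qed.

(** All products of degree at least three vanish, so the only new term is the product of the two
    linear parts. *)
Lemma coordM a a' :
  [/\ rho (a * a') = rho a * rho a',
      forall i, xi i (a * a') = rho a * xi i a' + rho a' * xi i a &
      quad (cw (a * a')) = quad (fun p => rho a * cw a' p + rho a' * cw a p +
        xi p.1 a * xi p.2 a')].
Proof.
apply: coord_unique.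
have linE c d y z : lin (fun i => y * c i + z * d i) = tau y * lin c + tau z * lin d.
  rewrite /lin !mulr_sumr -big_split; apply: eq_bigr => i _.
  by rewrite rmorphD !rmorphM /=; ring.
have quadE c d e y z : quad (fun p => y * c p + z * d p + e p) =
    tau y * quad c + tau z * quad d + quad e.
  rewrite /quad !mulr_sumr -!big_split; apply: eq_bigr => i _.
  by rewrite !rmorphD !rmorphM /=; ring.
have := mul_quad (cw a') (rho_quad (cw a)); have := mul_quad (cw a') (rho_lin (xi^~ a)).
have := mul_quad (cw a) (rho_lin (xi^~ a')).
rewrite linE quadE -(mul_lin (xi^~ a) (xi^~ a')) rmorphM.
move: (decomp a) (decomp a'); rewrite -/(lin (xi^~ a)) -/(lin (xi^~ a')).
rewrite -/(quad (cw a)) -/(quad (cw a')) => aE a'E l'q lq' qq'.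
rewrite {1}aE {1}a'E !(mulrDl, mulrDr) lq' qq' [quad _ * lin _]mulrC l'q; ring.
Qed.

Lemma coord_b j :
  [/\ rho (b j) = 0, forall i, xi i (b j) = (i == j)%:R & quad (cw (b j)) = quad (fun=> 0)].
Proof.
apply: coord_unique; rewrite rmorph0 add0r /lin /quad [X in _ = _ + X]big1 ?addr0.
  rewrite (bigD1 j) //= eqxx rmorph1 mul1r big1 ?addr0 // => i ij.
  by rewrite (negPf ij) rmorph0 mul0r.
by move=> p _; rewrite rmorph0 mul0r.
Qed.

Lemma coord1 :
  [/\ rho 1 = 1, forall i, xi i 1 = 0 & quad (cw 1) = quad (fun=> 0)].
Proof.
apply: coord_unique; rewrite rmorph1 /lin /quad.
by rewrite !big1 ?addr0 // => p _; rewrite rmorph0 mul0r.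
Qed.

(** * Semilinear functionals on [A] with values in an extension field *)

Section Lift.

Variables (L : fieldType) (sg : {rmorphism K -> L}).

(** The [sg]-semilinear functionals sending [b i] to [phi i], respectively [b i * b j] to
    [q (i, j)]. The second is meaningful once [q] respects the relations, as [q_rel] demands. *)
Definition lin_lift (phi : 'I_r -> L) a := \sum_i sg (xi i a) * phi i.
Definition quad_lift (q : 'I_r * 'I_r -> L) a := \sum_p sg (cw a p) * q p.

Lemma lin_liftD phi a a' : lin_lift phi (a + a') = lin_lift phi a + lin_lift phi a'.
Proof.
have [_ xiD _] := coordD a a'; rewrite /lin_lift -big_split; apply: eq_bigr => i _.
by rewrite xiD rmorphD mulrDl.
Qed.

Lemma lin_liftZ phi (c : k) a : lin_lift phi (c *: a) = sg c%:A * lin_lift phi a.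
Proof.
have [_ xiZ _] := coordZ c a; rewrite /lin_lift mulr_sumr; apply: eq_bigr => i _.
by rewrite xiZ -[c *: xi i a]mulr_algl rmorphM mulrA.
Qed.

Lemma lin_liftM phi a a' : lin_lift phi (a * a') =
  sg (rho a) * lin_lift phi a' + sg (rho a') * lin_lift phi a.
Proof.
have [_ xiM _] := coordM a a'; rewrite /lin_lift !mulr_sumr -big_split; apply: eq_bigr => i _.
by rewrite xiM rmorphD !rmorphM /=; ring.
Qed.

Lemma lin_lift_b phi j : lin_lift phi (b j) = phi j.
Proof.
have [_ xib _] := coord_b j; rewrite /lin_lift (bigD1 j) //= xib eqxx rmorph1 mul1r big1 ?addr0 //.
by move=> i ij; rewrite xib (negPf ij) rmorph0 mul0r.
Qed.

Lemma lin_lift1 phi : lin_lift phi 1 = 0.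
Proof.
by have [_ xi1 _] := coord1; rewrite /lin_lift big1 // => i _; rewrite xi1 rmorph0 mul0r.
Qed.

Lemma lin_lift_mul phi psi a a' :
  \sum_p sg (xi p.1 a) * sg (xi p.2 a') * (phi p.1 * psi p.2) =
  lin_lift phi a * lin_lift psi a'.
Proof.
rewrite /lin_lift big_distrlr /= pair_bigA /=; apply: eq_bigr => p _; ring.
Qed.

Variable q : 'I_r * 'I_r -> L.
Hypothesis q_rel : forall c, \sum_p tau (c p) * (b p.1 * b p.2) = 0 ->
  \sum_p sg (c p) * q p = 0.

(** Since [q] kills all relations, any coefficients of the quadratic part may replace the chosen
    [cw a]. *)
Lemma quad_liftE a d : quad (cw a) = quad d -> quad_lift q a = \sum_p sg (d p) * q p.
Proof.
move/eqP; rewrite -subr_eq0 quadB => /eqP/q_rel; rewrite /quad_lift.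
under eq_bigr do rewrite rmorphB mulrBl.
by rewrite sumrB => /eqP; rewrite subr_eq0 => /eqP.
Qed.

Lemma quad_liftD a a' : quad_lift q (a + a') = quad_lift q a + quad_lift q a'.
Proof.
have [_ _ /quad_liftE ->] := coordD a a'; rewrite -big_split; apply: eq_bigr => i _.
by rewrite rmorphD mulrDl.
Qed.

Lemma quad_liftZ (c : k) a : quad_lift q (c *: a) = sg c%:A * quad_lift q a.
Proof.
have [_ _ /quad_liftE ->] := coordZ c a; rewrite mulr_sumr; apply: eq_bigr => i _.
by rewrite -[c *: cw a i]mulr_algl rmorphM mulrA.
Qed.

Lemma quad_liftM a a' : quad_lift q (a * a') =
  sg (rho a) * quad_lift q a' + sg (rho a') * quad_lift q a +
  \sum_p sg (xi p.1 a) * sg (xi p.2 a') * q p.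
Proof.
have [_ _ /quad_liftE ->] := coordM a a'; rewrite /quad_lift !mulr_sumr -!big_split.
by apply: eq_bigr => i _; rewrite !rmorphD !rmorphM /=; ring.
Qed.

Lemma quad_lift1 : quad_lift q 1 = 0.
Proof.
have [_ _ /quad_liftE ->] := coord1; rewrite big1 // => p _.
by rewrite rmorph0 mul0r.
Qed.

End Lift.

(** The derivation takes [b_i b_j db_i] to [phi_i^2 psi_j t^2 z]: the remaining contributions carry
    a factor [psi_i = 0]. The factor 2 does not occur, so this works in every characteristic. *)
Lemma cubic_form_nonzero (L : fieldType) (sg : {rmorphism K -> L}) (phi psi : 'I_r -> L) i j :
    phi i != 0 -> psi i = 0 -> psi j != 0 ->
    (forall c, quad c = 0 -> \sum_p sg (c p) * (phi p.1 * phi p.2) = 0 /\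
       \sum_p sg (c p) * (phi p.1 * psi p.2 + psi p.1 * phi p.2) = 0) ->
  ~ omega_zero [:: (b i * b j, b i)].
Proof.
move=> phii psii psij rel0.
pose R a := sg (rho a).
pose F := lin_lift sg phi; pose P := lin_lift sg psi.
pose T := quad_lift sg (fun p => phi p.1 * phi p.2).
pose Q := quad_lift sg (fun p => phi p.1 * psi p.2 + psi p.1 * phi p.2).
have RD a a' : R (a + a') = R a + R a' by rewrite /R !rmorphD.
have RM a a' : R (a * a') = R a * R a' by rewrite /R !rmorphM.
have R1 : R 1 = 1 by rewrite /R !rmorph1.
have RZ (c : k) a : R (c *: a) = R c%:A * R a by rewrite -RM mulr_algl.
have FD a a' : F (a + a') = F a + F a' by apply: lin_liftD.
have FM a a' : F (a * a') = R a * F a' + R a' * F a by apply: lin_liftM.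
have PD a a' : P (a + a') = P a + P a' by apply: lin_liftD.
have PM a a' : P (a * a') = R a * P a' + R a' * P a by apply: lin_liftM.
have TD a a' : T (a + a') = T a + T a'.
  by apply: quad_liftD => c /rel0[].
have TM a a' : T (a * a') = R a * T a' + R a' * T a + F a * F a'.
  by rewrite /T quad_liftM ?lin_lift_mul // => c /rel0[].
have QD a a' : Q (a + a') = Q a + Q a'.
  by apply: quad_liftD => c /rel0[].
have QM a a' : Q (a * a') = R a * Q a' + R a' * Q a + (F a * P a' + P a * F a').
  rewrite /Q quad_liftM; last by move=> c /rel0[].
  by under [X in _ + X = _]eq_bigr do rewrite mulrDr; rewrite big_split /= !lin_lift_mul.
have F1 : F 1 = 0 by apply: lin_lift1.
have P1 : P 1 = 0 by apply: lin_lift1.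
have T1 : T 1 = 0 by apply: quad_lift1 => c /rel0[].
have Q1 : Q 1 = 0 by apply: quad_lift1 => c /rel0[].
(* [L^5] is the ideal [(t, z)] of [L[t,z]/(z^2, t^3)] in the basis [t], [z],
   [t^2], [t z], [t^2 z], on which [a] acts as
   [R a + F a t + P a z + T a t^2 + Q a t z]. *)
pose act a (v : L * L * L * L * L) : L * L * L * L * L :=
  let: (n1, n2, n3, n4, n5) := v in
  (R a * n1, R a * n2, R a * n3 + F a * n1, R a * n4 + F a * n2 + P a * n1,
   R a * n5 + F a * n4 + P a * n3 + T a * n2 + Q a * n1).
(* The weights of [t], [z], [t^2], [t z], [t^2 z] under [t d/dt - 2 z d/dz] are 1, -2, 2, -1, 0. As
   [t^2 z] has weight 0, the derivation is defined modulo [t^2 z] but takes values where [t^2 z]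
   survives. *)
pose D a : L * L * L * L * L := (F a, - (P a + P a), T a + T a, - Q a, 0).
have kF (c : k) : F c%:A = 0.
  by rewrite /F lin_liftZ -/F F1 mulr0.
have kP (c : k) : P c%:A = 0.
  by rewrite /P lin_liftZ -/P P1 mulr0.
have kT (c : k) : T c%:A = 0.
  by rewrite /T quad_liftZ -/T ?T1 ?mulr0 // => d /rel0[].
have kQ (c : k) : Q c%:A = 0.
  by rewrite /Q quad_liftZ -/Q ?Q1 ?mulr0 // => d /rel0[].
move=> /(omega_zero_action (act := act) (D := D)) w0.
have : \sum_(p <- [:: (b i * b j, b i)]) act p.1 (D p.2) = 0.
  apply: w0.
  - move=> a a' [[[[n1 n2] n3] n4] n5] /=; rewrite RM FM PM TM QM.
    by congr (_, _, _, _, _); ring.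
  - move=> [[[[n1 n2] n3] n4] n5] /=; rewrite R1 F1 P1 T1 Q1.
    by congr (_, _, _, _, _); ring.
  - move=> a [[[[n1 n2] n3] n4] n5] [[[[m1 m2] m3] m4] m5] /=.
    by congr (_, _, _, _, _) => /=; ring.
  - move=> [[[[n1 n2] n3] n4] n5] a a' /=; rewrite RD FD PD TD QD.
    by congr (_, _, _, _, _) => /=; ring.
  - move=> a a'; rewrite /D FD PD TD QD.
    by congr (_, _, _, _, _) => /=; ring.
  - move=> c a; rewrite -[c *: a]mulr_algl /D /act FM PM TM QM kF kP kT kQ.
    by congr (_, _, _, _, _) => /=; ring.
  - move=> a a'; rewrite /D /act FM PM TM QM.
    by congr (_, _, _, _, _) => /=; ring.
rewrite big_seq1 /=.
have bF l : F (b l) = phi l by apply: lin_lift_b.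
have bP l : P (b l) = psi l by apply: lin_lift_b.
have bR l : R (b l) = 0 by rewrite /R rho_b rmorph0.
move/(congr1 snd) => /=; rewrite RM FM PM TM QM !bF !bP !bR psii
  !(mul0r, mulr0, add0r, addr0, oppr0).
by apply/eqP; rewrite !mulf_neq0.
Qed.

(** A relation that is asymmetric at [(i, j)] serves if one exists; otherwise the commutativity
    relation of [b i] and [b j] does. *)
Lemma relation_form_nonzero (i j : 'I_r) : i != j ->
  exists c, quad c = 0 /\ ~ omega_zero [seq (tau (c p) * b p.1, b p.2) | p <- index_enum _].
Proof.
move=> ij.
pose e (i j : 'I_r) (p : 'I_r * 'I_r) : K := (p == (i, j))%:R.
have sum_e (F : 'I_r * 'I_r -> K) i' j' : \sum_p F p * e i' j' p = F (i', j').
  rewrite (bigD1 (i', j')) //= /e eqxx mulr1 big1 ?addr0 // => p pij.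
  by rewrite (negPf pij) mulr0.
(* For [s = 1] the form [X a * Y a' - s Y a * X a'] defining the action on [K^3]
   is alternating and needs no correction on [M^2]; for [s = 0] its
   symmetrization has to vanish on the relations. *)
have key s (c : 'I_r * 'I_r -> K) :
    (forall d, quad d = 0 -> (1 - s) * (d (i, j) + d (j, i)) = 0) ->
    omega_zero [seq (tau (c p) * b p.1, b p.2) | p <- index_enum _] ->
  c (i, j) = s * c (j, i).
  move=> rel0.
  pose sg : {rmorphism K -> K} := idfun.
  pose q p := (1 - s) * (e i j p + e j i p).
  have q_rel d : quad d = 0 -> \sum_p sg (d p) * q p = 0.
    move=> d0; rewrite -[RHS](rel0 d d0) -[d (i, j)](sum_e d) -[d (j, i)](sum_e d).
    by rewrite -big_split mulr_sumr; apply: eq_bigr => p _ /=; rewrite /sg /q /=; ring.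
  pose X a := xi i a; pose Y a := xi j a; pose Z := quad_lift sg q.
  have RM a a' : rho (a * a') = rho a * rho a' by rewrite rmorphM.
  have XD a a' : X (a + a') = X a + X a' by rewrite /X /Y; have [_ -> _] := coordD a a'.
  have YD a a' : Y (a + a') = Y a + Y a' by rewrite /X /Y; have [_ -> _] := coordD a a'.
  have XM a a' : X (a * a') = rho a * X a' + rho a' * X a
    by rewrite /X /Y; have [_ -> _] := coordM a a'.
  have YM a a' : Y (a * a') = rho a * Y a' + rho a' * Y a
    by rewrite /X /Y; have [_ -> _] := coordM a a'.
  have ZD a a' : Z (a + a') = Z a + Z a' by apply: quad_liftD.
  have ZM a a' : Z (a * a') = rho a * Z a' + rho a' * Z a +
      (1 - s) * (X a * Y a' + Y a * X a').
    rewrite /Z quad_liftM //; congr (_ + _).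
    rewrite -[X a * Y a'](sum_e (fun p => xi p.1 a * xi p.2 a')).
    rewrite -[Y a * X a'](sum_e (fun p => xi p.1 a * xi p.2 a')).
    rewrite -big_split mulr_sumr; apply: eq_bigr => p _ /=; rewrite /sg /q /=; ring.
  have [_ xi1 _] := coord1.
  have X1 : X 1 = 0 by apply: xi1.
  have Y1 : Y 1 = 0 by apply: xi1.
  have kX (t : k) : X t%:A = 0 by rewrite /X /Y; have [_ -> _] := coordZ t 1; rewrite xi1 scaler0.
  have kY (t : k) : Y t%:A = 0 by rewrite /X /Y; have [_ -> _] := coordZ t 1; rewrite xi1 scaler0.
  have kZ (t : k) : Z t%:A = 0 by rewrite /Z quad_liftZ // quad_lift1 ?mulr0.
  pose act a (v : K * K * K) : K * K * K :=
    let: (u, v, z) := v in (rho a * u, rho a * v, rho a * z + X a * v - s * (Y a * u)).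
  pose D a : K * K * K := (X a, Y a, Z a).
  move=> /(omega_zero_action (act := act) (D := D)) w0.
  have {w0} : \sum_(p <- [seq (tau (c p) * b p.1, b p.2) | p <- index_enum _]) act p.1 (D p.2) = 0.
    apply: w0.
    - by move=> a a' [[u v] z] /=; rewrite RM XM YM; congr (_, _, _) => /=; ring.
    - by move=> [[u v] z] /=; rewrite rmorph1 X1 Y1; congr (_, _, _) => /=; ring.
    - by move=> a [[u v] z] [[u' v'] z'] /=; congr (_, _, _) => /=; ring.
    - by move=> [[u v] z] a a' /=; rewrite rmorphD XD YD; congr (_, _, _) => /=; ring.
    - by move=> a a'; rewrite /D XD YD ZD.
    - move=> t a; rewrite -[t *: a]mulr_algl /D /act XM YM ZM kX kY kZ.
      by congr (_, _, _) => /=; ring.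
    - by move=> a a'; rewrite /D /act XM YM ZM; congr (_, _, _) => /=; ring.
  rewrite big_map => /(congr1 snd); rewrite (big_morph snd (fun _ _ => erefl) erefl) /=.
  have Xb l : X (b l) = (i == l)%:R by rewrite /X /Y; have [_ -> _] := coord_b l.
  have Yb l : Y (b l) = (j == l)%:R by rewrite /X /Y; have [_ -> _] := coord_b l.
  under eq_bigr do rewrite RM XM YM !Xb !Yb !rho_b tauK.
  move=> c0; apply/eqP; rewrite -subr_eq0 -[c (i, j)](sum_e c) -[c (j, i)](sum_e c).
  rewrite mulr_sumr -sumrB; apply/eqP; rewrite -[RHS]c0; apply: eq_bigr => [[p1 p2]] _ /=.
  rewrite /e !xpair_eqE ![_ == i]eq_sym ![_ == j]eq_sym -!mulnb !natrM; ring.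
have quad_e i' j' : quad (e i' j') = b i' * b j'.
  rewrite /quad (bigD1 (i', j')) //= /e eqxx rmorph1 mul1r big1 ?addr0 // => p pij.
  by rewrite (negPf pij) rmorph0 mul0r.
case: (classic (exists c, quad c = 0 /\ c (i, j) != c (j, i))) => [[c [c0 cij]]|sym].
  (* For [s = 1] the condition on relations carries the factor [1 - s = 0]. *)
  exists c; split=> // /(key 1); rewrite mul1r => cE; move/eqP: cij; apply; apply: cE => d _.
  by rewrite subrr mul0r.
have {}sym c : quad c = 0 -> c (i, j) = c (j, i).
  by move=> c0; apply/eqP/negPn/negP => cij; apply: sym; exists c.
have e0 : quad (fun p => e i j p - e j i p) = 0.
  by rewrite -quadB !quad_e mulrC subrr.
have eij : e i j (i, j) - e j i (i, j) = 1.
  by rewrite /e eqxx xpair_eqE (negPf ij) subr0.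
have eji : e i j (j, i) - e j i (j, i) = -1.
  by rewrite /e eqxx xpair_eqE [j == i]eq_sym (negPf ij) sub0r.
(* For [s = 0], vanishing would give [1 = 0]. The condition [d (i, j) + d (j, i) = 0] holds because
   relations are symmetric, and symmetry of the commutator itself says [-1 = 1]. *)
exists (fun p => e i j p - e j i p); split=> // /(key 0); rewrite eij eji mul0r => c1.
move/eqP: (oner_neq0 K); apply; apply: c1 => d /sym ->.
by have := sym _ e0; rewrite eij eji subr0 mul1r => m1; rewrite -[X in X + _]mul1r m1 mulN1r addNr.
Qed.

End Coordinates.

(** * Maps to truncated polynomial rings *)

(** The modulus is normalized to ['X^(n.-1.+1)], which is ['X^n] for positive [n]. *)
Lemma in_trunc_eq0 (L : fieldType) n (p : {poly L}) : (0 < n)%N ->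
  in_qpoly 'X^n p = 0 -> 'X^n %| p.
Proof.
move=> n_gt0 /(congr1 val) /= p0; move: p0; rewrite mk_monic_Xn prednK // => p0.
by rewrite (Pdiv.RingMonic.rdivp_eq (monicXn L n) p) p0 addr0 dvdp_mull.
Qed.

Lemma size_trunc (L : fieldType) n (p : trunc_poly L n) : (0 < n)%N ->
  (size (p : {poly L}) <= n)%N.
Proof.
move=> n_gt0; have E : size (mk_monic ('X^n : {poly L})) = n.+1.
  by rewrite mk_monic_Xn prednK // size_polyXn.
by rewrite -ltnS -E; exact: size_mk_monic.
Qed.

(** Uniqueness in Hensel's lemma: [g y] and its constant term [z0] are roots, with the same residue,
    of the separable minimal polynomial of [y], hence equal. *)
Lemma trunc_poly_const (k : fieldType) (K L : fieldExtType k) (n : nat)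
    (g : K -> trunc_poly L n) :
    perfect_field k -> (0 < n)%N ->
    (forall y z, g (y + z) = g y + g z) -> (forall y z, g (y * z) = g y * g z) ->
    g 1 = 1 -> (forall (c : k) y, g (c *: y) = (c%:A : L) *: g y) ->
  forall y, g y = (g y : {poly L})`_0 *: 1.
Proof.
move=> perf n_gt0 gD gM g1 gZ y.
have g0 : g 0 = 0 by apply: (addrI (g 0)); rewrite -gD !addr0.
have /polyOver1P[q mq] := minPolyOver 1 y.
have qy : horner_alg y q = 0 by have := root_minPoly 1 y; rewrite mq => /eqP.
pose Z : {poly L} := g y; pose z0 := Z`_0.
pose lift (s : {poly k}) : {poly {poly L}} := map_poly (polyC \o in_alg L) s.
have in_lift s : in_qpoly 'X^n (lift s).[Z] = g (horner_alg y s).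
  elim/poly_ind: s => [|s c IHs]; first by rewrite /lift !rmorph0 horner0 g0 rmorph0.
  rewrite /lift !rmorphD !rmorphM /= map_polyX map_polyC /= hornerMXaddC.
  rewrite -/(lift s) horner_algX horner_algC gD gM gZ g1 -IHs rmorphD rmorphM /=.
  congr (_ * _ + _); first exact/val_inj/in_qpoly_small/size_mk_monic.
  by rewrite -alg_polyC in_qpolyZ in_qpoly1.
have Xq : 'X^n %| (lift q).[Z].
  by apply: in_trunc_eq0 => //; rewrite in_lift qy g0.
have lift_at0 s (P : {poly L}) : ((lift s).[P]).[0] = (map_poly (in_alg L) s).[P.[0]].
  elim/poly_ind: s => [|s c IHs]; first by rewrite /lift !rmorph0 !horner0.
  rewrite /lift !rmorphD !rmorphM /= !map_polyX !map_polyC /= !hornerMXaddC.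
  by rewrite hornerD hornerM hornerC -/(lift s) IHs.
have lift_const s c : (lift s).[c%:P] = ((map_poly (in_alg L) s).[c])%:P.
  elim/poly_ind: s => [|s d IHs]; first by rewrite /lift !rmorph0 !horner0.
  rewrite /lift !rmorphD !rmorphM /= !map_polyX !map_polyC /= !hornerMXaddC.
  by rewrite -/(lift s) IHs polyCD polyCM.
have qz0 : (map_poly (in_alg L) q).[z0] = 0.
  rewrite /z0 -horner_coef0 -lift_at0; apply/eqP; rewrite -rootE -dvdp_XsubCl subr0.
  by rewrite (dvdp_trans _ Xq) // -[X in X %| _]expr1 dvdp_exp2l.
have dqz0 : (map_poly (in_alg L) q^`()).[z0] != 0.
  have := perfect_separable perf y; rewrite /separable_element mq separable_map => sepq.
  have : separable_poly (map_poly (in_alg L) q) by rewrite separable_map.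
  rewrite unlock deriv_map => /coprimep_root; apply; exact/eqP.
have [R] := taylor2 (lift q) z0%:P (Z - z0%:P).
rewrite addrC subrK lift_const qz0 polyC0 add0r expr2 mulrA -mulrDl mulrC => RE.
set H := Z - z0%:P in RE.
have H0 : H.[0] = 0 by rewrite hornerD hornerN hornerC horner_coef0 subrr.
have /dvdXn_factor[c [d [cd cH dV]]] : 'X^n %| H * ((lift q)^`().[z0%:P] + R * H).
  by rewrite -RE.
(* The second factor has constant term [q'(z0)], which is nonzero, so all [n] copies of ['X] divide
   [H]; its size then forces [H = 0]. *)
have d0 : d = 0%N.
  case: d dV {cd} => // d dV.
  have : 'X %| (lift q)^`().[z0%:P] + R * H.
    by rewrite (dvdp_trans _ dV) // -[X in X %| _]expr1 dvdp_exp2l.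
  rewrite -['X]subr0 -polyC0 dvdp_XsubCl rootE hornerD hornerM H0 mulr0 addr0.
  by rewrite /lift deriv_map -/(lift _) lift_const hornerC (negPf dqz0).
apply: val_inj; rewrite /= alg_polyC; apply/eqP; rewrite -subr_eq0 -/Z -/z0 -/H.
move: cd; rewrite d0 addn0 => cn; move: cH; rewrite cn; apply: contraTT => HN0.
rewrite gtNdvdp // size_polyXn ltnS.
rewrite (leq_trans (size_polyD _ _)) // geq_max size_trunc //= size_polyN.
by rewrite (leq_trans (size_polyC_leq1 _)).
Qed.

(** Every element is a unit times [1], [b] or [b * b], or is zero, so the ideals are those generated
    by [1], [b], [b * b] and [0]. The cases ask for the first power having a unit multiple in
    [I]. *)
Lemma PIA_of_principal_max (k : fieldType) (A : comAlgType k) (K : fieldType)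
    (rho : {rmorphism A -> K}) (b : A) :
    finite_kalg A ->
    (forall x, rho x != 0 -> exists y, x * y = 1) ->
    (forall x y z, rho x = 0 -> rho y = 0 -> rho z = 0 -> x * y * z = 0) ->
    rho b = 0 -> (forall x, rho x = 0 -> exists a, x = a * b) ->
  PIA A.
Proof.
move=> finA unitA cube0 b0 maxb; split=> // I [I0 _ IM].
case: (classic (exists x, I x /\ rho x != 0)) => [[x [Ix /unitA[y xy]]]|no1].
  exists 1 => z; split=> [_|_]; first by exists z; rewrite mulr1.
  by rewrite -[z]mulr1 -xy [x * y]mulrC mulrA; apply: IM.
have {}no1 x : I x -> rho x = 0.
  by move=> Ix; apply/eqP/negPn/negP => x0; apply: no1; exists x.
case: (classic (exists u, I (u * b) /\ rho u != 0)) => [[u [Iu /unitA[v uv]]]|no2].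
  exists b => z; split=> [/no1/maxb //|[a ->]].
  suff -> : a * b = a * v * (u * b) by apply: IM.
  by rewrite [RHS]mulrA -(mulrA a) [v * u]mulrC uv mulr1.
have {}no2 u : I (u * b) -> rho u = 0.
  by move=> Iu; apply/eqP/negPn/negP => u0; apply: no2; exists u.
have Ib z : I z -> exists a, z = a * (b * b).
  move=> Iz; have [a za] := maxb z (no1 z Iz); move: Iz; rewrite za => /no2/maxb[a' ->].
  by exists a'; rewrite mulrA.
case: (classic (exists u, I (u * (b * b)) /\ rho u != 0)) => [[u [Iu /unitA[v uv]]]|no3].
  exists (b * b) => z; split=> [/Ib //|[a ->]].
  suff -> : a * (b * b) = a * v * (u * (b * b)) by apply: IM.
  by rewrite [RHS]mulrA -(mulrA a) [v * u]mulrC uv mulr1.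
exists 0 => z; split=> [Iz|[a ->]]; last by rewrite mulr0.
have [a za] := Ib z Iz; exists 0; rewrite mulr0 za mulrA cube0 //.
by apply/eqP/negPn/negP => a0; apply: no3; exists a; rewrite -za.
Qed.

(** * Nonvanishing of [tau] *)

(** With [A] a [K]-space through [tau], the [b i] lift a basis of the maximal ideal modulo its
    square [M2]; their products then span [M2]. *)
Lemma coordinates_exist (k : fieldType) (A : comAlgType k) (K : fieldExtType k)
    (rho : {rmorphism A -> K}) (tau : {rmorphism K -> A}) :
    finite_kalg A ->
    (forall c a, rho (c *: a) = c *: rho a) ->
    (forall c y, tau (c *: y) = c *: tau y) -> (forall y, rho (tau y) = y) ->
    (forall x y z, rho x = 0 -> rho y = 0 -> rho z = 0 -> x * y * z = 0) ->
  exists (r : nat) (b : 'I_r -> A) (xi : 'I_r -> A -> K) (cw : A -> 'I_r * 'I_r -> K),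
    [/\ forall i, rho (b i) = 0,
        forall a, a = tau (rho a) + \sum_i tau (xi i a) * b i +
                      \sum_p tau (cw a p) * (b p.1 * b p.2) &
        forall c d, \sum_i tau (c i) * b i + \sum_p tau (d p) * (b p.1 * b p.2) = 0 ->
          forall i, c i = 0].
Proof.
move=> [s spans] rhoZ tauZ tauK cube0.
pose M2 x := exists l : seq (A * A),
  (forall p, p \in l -> rho p.1 = 0 /\ rho p.2 = 0) /\ x = \sum_(p <- l) p.1 * p.2.
pose scale (y : K) (a : A) := tau y * a.
have sA x y a : scale x (scale y a) = scale (x * y) a.
  by rewrite /scale mulrA rmorphM.
have s1 : left_id 1 scale by move=> a; rewrite /scale rmorph1 mul1r.
have sDr : right_distributive scale +%R by move=> y a a'; exact: mulrDr.
have sDl a : {morph scale^~ a : x y / x + y}.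
  by move=> x y; rewrite /scale rmorphD mulrDl.
pose Z : zmodType := A.
pose V : lmodType K := HB.pack (GRing.Zmodule.sort Z) Z
  (GRing.Zmodule_isLmodule.Build K A sA s1 sDr sDl).
have M20 : M2 0 by exists [::]; rewrite big_nil.
have M2lin y u v : M2 u -> M2 v -> M2 (tau y * u + v).
  move=> [l [lM ->]] [l' [lM' ->]].
  exists ([seq (tau y * p.1, p.2) | p <- l] ++ l'); split.
    move=> p; rewrite mem_cat => /orP[/mapP[q ql ->]|/lM' //].
    by have [q1 q2] := lM q ql; rewrite /= rmorphM q1 mulr0.
  rewrite big_cat big_map /= mulr_sumr; congr (_ + _).
  by apply: eq_bigr => p _; rewrite mulrA.
have mulM2 x u : rho x = 0 -> M2 u -> x * u = 0.
  move=> x0 [l [lM ->]]; rewrite mulr_sumr big_seq big1 // => p /lM[p1 p2].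
  by rewrite mulrA cube0.
have [|r [b [b0 spanb freeb]]] := @basis_mod K V M2 (fun a => rho a = 0) M2lin M20.
  (* Subtracting residues moves the generators into the maximal ideal, where they still span. *)
  pose s' := [seq a - tau (rho a) | a <- s].
  have szs : size s' = size s by rewrite size_map.
  exists s'; split=> [i|a a0].
    by rewrite (nth_map 0) -?szs // rmorphB /= tauK subrr.
  have [c aE] := spans a.
  exists (fun i => (c (cast_ord szs i))%:A).
  suff -> : \sum_i (c (cast_ord szs i))%:A *: (s'`_i : V) = a by rewrite subrr.
  have at0 : (a : A) - tau (rho a) = a by rewrite a0 rmorph0 subr0.
  rewrite -[RHS]at0 aE !rmorph_sum -sumrB (reindex (cast_ord (esym szs))) /=; last first.
    by exists (cast_ord szs) => i _; rewrite ?cast_ordK ?cast_ordKV.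
  apply: eq_bigr => i _; rewrite cast_ordKV (nth_map 0) // rhoZ tauZ. rewrite -scalerBr.
  by rewrite /GRing.scale /= /scale tauZ rmorph1 mulr_algl.
have linE (c : 'I_r -> K) : \sum_i c i *: (b i : V) = \sum_i tau (c i) * b i by [].
have rho_lin (c : 'I_r -> K) : rho (\sum_i tau (c i) * b i) = 0.
  by rewrite rmorph_sum big1 // => i _; rewrite rmorphM /= b0 mulr0.
(* Changing a factor by an element of [M2] leaves the product unchanged, as the cube is zero. *)
have M2mul x y : rho x = 0 -> rho y = 0 -> exists d : 'I_r * 'I_r -> K,
    x * y = \sum_p tau (d p) * (b p.1 * b p.2).
  move=> x0 y0; have [c M2x] := spanb x x0; have [d M2y] := spanb y y0.
  rewrite linE in M2x; rewrite linE in M2y.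
  exists (fun p => c p.1 * d p.2); rewrite -(mul_lin tau b c d).
  have := mulM2 _ _ y0 M2x; rewrite mulrBr => /eqP; rewrite subr_eq0 mulrC => /eqP ->.
  rewrite mulrC; have := mulM2 _ _ (rho_lin c) M2y; rewrite mulrBr => /eqP.
  by rewrite subr_eq0 => /eqP ->.
have M2quad x : M2 x -> exists d : 'I_r * 'I_r -> K,
    x = \sum_p tau (d p) * (b p.1 * b p.2).
  case=> l [+ ->]; elim: l => [|p l IHl] lM.
    exists (fun=> 0); rewrite big_nil big1 // => p _; by rewrite rmorph0 mul0r.
  have [q ql|d dE] := IHl; first by apply: lM; rewrite inE ql orbT.
  have [p1 p2] := lM p (mem_head _ _); have [e eE] := M2mul _ _ p1 p2.
  exists (fun p => e p + d p); rewrite big_cons dE eE -big_split.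
  by apply: eq_bigr => q _; rewrite rmorphD mulrDl.
have ex a : exists cd : ('I_r -> K) * ('I_r * 'I_r -> K),
    a = tau (rho a) + \sum_i tau (cd.1 i) * b i + \sum_p tau (cd.2 p) * (b p.1 * b p.2).
  have [|c] := spanb (a - tau (rho a)); first by rewrite rmorphB /= tauK subrr.
  rewrite linE => /M2quad[d dE]; exists (c, d); rewrite /= -dE; ring.
have [f fP] := choice _ ex.
exists r, b, (fun i a => (f a).1 i), (fun a => (f a).2); split=> // c d cd0.
apply: freeb; rewrite linE.
(* The linear part equals minus the quadratic part, hence lies in [M2]; the added zero gives the
   shape of [M2lin]. *)
have -> : \sum_i tau (c i) * b i = \sum_p tau (- d p) * (b p.1 * b p.2) + 0.
  move/eqP: cd0; rewrite addr_eq0 addr0 => /eqP ->; rewrite -sumrN.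
  by apply: eq_bigr => p _; rewrite rmorphN mulNr.
apply: (big_ind (fun x => M2 (x + 0))) => [|x y|p _]; first by rewrite addr0.
  by rewrite !addr0 => Mx My; have := M2lin 1 x y Mx My; rewrite rmorph1 mul1r.
apply: M2lin => //; exists [:: (b p.1, b p.2)]; rewrite big_seq1; split=> // q.
by rewrite inE => /eqP -> /=; rewrite !b0.
Qed.

(** The image of [tau] consists of constants, so [f] followed by [pi] is semilinear along an
    embedding [sg]. On polynomial representatives, products agree only modulo ['X^n]. *)
Lemma trunc_poly_coords (k : fieldType) (A B : comAlgType k) (K L : fieldExtType k)
    (tau : {rmorphism K -> A}) (f : A -> B) (n : nat) (pi : B -> trunc_poly L n) :
    perfect_field k -> (0 < n)%N -> (forall c y, tau (c *: y) = c *: tau y) ->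
    kalg_hom f ->
    [/\ forall a b, pi (a + b) = pi a + pi b, forall a b, pi (a * b) = pi a * pi b,
        pi 1 = 1 & forall (c : k) a, pi (c *: a) = (c%:A : L) *: pi a] ->
  exists sg : {rmorphism K -> L},
    [/\ forall y a, pi (f (tau y * a)) = sg y *: (pi (f a) : {poly L}) :> {poly L},
        forall a a', 'X^n %| (pi (f a) : {poly L}) * (pi (f a') : {poly L})
                            - (pi (f (a * a')) : {poly L}),
        pi (f 0) = 0 :> {poly L} &
        forall a a', pi (f (a + a')) = (pi (f a) : {poly L}) + pi (f a') :> {poly L}].
Proof.
move=> perf n_gt0 tauZ [fD fM f1 fZ] [piD piM pi1 piZ].
pose h a := pi (f a).
have hD a a' : h (a + a') = h a + h a' by rewrite /h fD piD.
have hM a a' : h (a * a') = h a * h a' by rewrite /h fM piM.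
have h1 : h 1 = 1 by rewrite /h f1 pi1.
have h0 : h 0 = 0 by apply: (addrI (h 0)); rewrite -hD !addr0.
have hZ (c : k) a : h (c *: a) = (c%:A : L) *: h a by rewrite /h fZ piZ.
have hconst y : h (tau y) = (h (tau y) : {poly L})`_0 *: 1.
  apply: (@trunc_poly_const k K L n (h \o tau)) => //= *.
  - by rewrite rmorphD hD.
  - by rewrite rmorphM hM.
  - by rewrite rmorph1.
  - by rewrite tauZ hZ.
pose sg y : L := (h (tau y) : {poly L})`_0.
have sgB : zmod_morphism sg.
  move=> y z; rewrite /sg; have -> : h (tau y) = h (tau (y - z)) + h (tau z).
    by rewrite -hD -rmorphD subrK.
  by rewrite coefD addrK.
have sgM : monoid_morphism sg.
  split=> [|y z]; first by rewrite /sg rmorph1 h1 /= coefC.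
  rewrite /sg rmorphM hM (hconst y) (hconst z) -scalerAl mul1r scalerA /=.
  by rewrite !coefZ !coefC /= !mulr1.
pose S : {rmorphism K -> L} := HB.pack sg
  (GRing.isZmodMorphism.Build K L sg sgB) (GRing.isMonoidMorphism.Build K L sg sgM).
exists S; split=> [y a|a a'||a a'].
- by rewrite -/(h _) hM hconst -scalerAl mul1r.
- rewrite -!/(h _) hM.
  suff Xmod (P : {poly L}) : 'X^n %| P - Pdiv.Ring.rmodp P (mk_monic 'X^n) by exact: Xmod.
  rewrite mk_monic_Xn prednK //.
  by rewrite {1}(Pdiv.RingMonic.rdivp_eq (monicXn L n) P) addrK dvdp_mull.
- by rewrite -/(h 0) h0.
- by rewrite -/(h _) hD.
Qed.

Theorem theorem2p11 (k : fieldType) (A : comAlgType k) :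
  perfect_field k ->
  finite_kalg A ->
  local_alg A ->
  max_cube_zero A ->
  ~ PIA A ->
  tau_nonzero A.
Proof.
move=> perf finA locA cubeA notPIA.
have [K [rho [rhoZ rho_surj rhoP]]] := residue_fieldExt locA finA.
have unitA x : rho x != 0 -> exists y, x * y = 1.
  by move=> /eqP x0; apply: NNPP => /rhoP.
have cube0 x y z : rho x = 0 -> rho y = 0 -> rho z = 0 -> x * y * z = 0.
  by move=> /rhoP ? /rhoP ? /rhoP ?; apply: cubeA.
have [tau [tauZ tauK]] := coefficient_field perf rhoZ rho_surj unitA cube0.
have [r [b [xi [cw [rho_b decomp free]]]]] :=
  coordinates_exist finA rhoZ tauZ tauK cube0.
(* With at most one basis vector the maximal ideal is principal, against the hypothesis. *)
have r_gt1 : (1 < r)%N.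
  rewrite ltnNge; apply/negP => r_le1; apply: notPIA.
  case: r r_le1 b xi cw rho_b decomp free => [_|[_|//]] b xi cw rho_b decomp _.
    apply: (@PIA_of_principal_max k A K rho 0) => // [|x x0]; first exact: rmorph0.
    exists 0; rewrite mulr0 [LHS]decomp x0 rmorph0 big_ord0 addr0 add0r big1 //.
    by case=> [[]].
  apply: (@PIA_of_principal_max k A K rho (b ord0)) => // x x0.
  exists (tau (xi ord0 x) + tau (cw x (ord0, ord0)) * b ord0).
  rewrite [LHS]decomp x0 rmorph0 add0r big_ord1 mulrDl -mulrA; congr (_ + _).
  by rewrite (bigD1 (ord0, ord0)) //= big1 ?addr0 // => -[i j]; rewrite !ord1 eqxx.
(* A nonzero [b_i b_j db_i] is in [tau] because [b_i b_j b_i = 0]. *)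
case: (classic (exists i j, ~ omega_zero [:: (b i * b j, b i)])) => [[i [j nz]]|cubic0].
  exists [:: (b i * b j, b i)]; split=> // B [m [L [n [pi [n_gt0 tame piP inj surj]]]]] f fh.
  apply: (omega_zero_tame perf n_gt0 tame piP inj surj) => l.
  have [sg [_ piM pi0 _]] := trunc_poly_coords perf (n_gt0 l) tauZ fh (piP l).
  rewrite big_seq1 /=; apply: dvdXn_mul_deriv.
  by have := piM (b i * b j) (b i); rewrite cube0 // pi0 subr0.
have {}cubic0 i j : omega_zero [:: (b i * b j, b i)].
  by apply: NNPP => nz; apply: cubic0; exists i, j.
have ij : Ordinal (ltnW r_gt1) != Ordinal r_gt1 by [].
have [c [c0 nz]] := relation_form_nonzero tauZ tauK cube0 rho_b decomp free ij.
exists [seq (tau (c p) * b p.1, b p.2) | p <- index_enum _]; split=> // B.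
move=> [m [L [n [pi [n_gt0 tame piP inj surj]]]]] f fh.
apply: (omega_zero_tame perf n_gt0 tame piP inj surj) => l.
have [sg [piZ piM pi0 piD]] := trunc_poly_coords perf (n_gt0 l) tauZ fh (piP l).
pose P i : {poly L l} := pi l (f (b i)).
(* A relation in [A] becomes a relation modulo ['X^(n l)] among the images [P]. *)
have relP d : \sum_p tau (d p) * (b p.1 * b p.2) = 0 ->
    'X^(n l) %| \sum_p (sg (d p))%:P * (P p.1 * P p.2).
  move=> d0; have := pi0; rewrite -d0.
  rewrite (big_morph (fun a => pi l (f a) : {poly _}) piD pi0) => sum0.
  rewrite -[X in _ %| X]subr0 -[X in _ - X]sum0 -sumrB; apply: dvdp_sumr => p.
  rewrite piZ -mul_polyC -mulrBr; apply: dvdp_mull; exact: piM.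
rewrite !big_map.
have [left|[phi [psi [i [j [phii psii psij rel0]]]]]] := quadric_dichotomy (n l) P.
  rewrite (eq_bigr (fun p => (sg (c p))%:P * (P p.1 * (P p.2)^`()))) => [|p _].
    exact: (left _ (relP c c0)).
  by rewrite /= piZ -mul_polyC mulrA.
(* A tangent vector would make some [b_i b_j db_i] nonzero, contrary to [cubic0]. *)
exfalso; apply: (cubic_form_nonzero tauZ tauK cube0 rho_b decomp free
  phii psii psij _ (cubic0 i j)).
move=> d d0; exact: (rel0 (fun p => sg (d p)) (relP d d0)).
Qed.
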